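(* Let $G$ be a finite group, $A$ a finite set of size $q\geq 2$, and let $R$ be the submonoid \[ R := \left\{ \sigma \in \mathrm{CA}(G;A) : G_x = G_{(x)\sigma} \text{ for all } x \in A^G \right\} \] of $\mathrm{CA}(G;A)$. Let $H_1, H_2, \dots, H_r$ be a complete list of representatives for the conjugacy classes of subgroups of $G$. Then there is an isomorphism of monoids \[ R \cong \prod_{i=1}^r (N_G(H_i)/ H_i) \wr \mathrm{Tran}_{\alpha_i}, \] where $\alpha_i = \alpha_{[H_i]}(G;A)$ is the number of $G$-orbits contained in the box $B_{[H_i]}$.
   Context: Functions are applied on the right, and composition is read left to right: $\tau\sigma$ (or $\tau\circ\sigma$) means first $\tau$, then $\sigma$. For a group $G$ and a set $A$, $A^G$ is the set of all functions $x: G\to A$; $G$ acts on $A^G$ by $(h)(x\cdot g) := (hg^{-1})x$ for $g,h\in G$, $x\in A^G$. A cellular automaton over $A^G$ is a map $\tau : A^G \to A^G$ for which there exist a finite subset $S \subseteq G$ (a memory set) and a function $\mu : A^S \to A$ (a local function) such that $(g)(x)\tau = ((x\cdot g^{-1})|_S)\mu$ for all $x\in A^G$, $g\in G$. $\mathrm{CA}(G;A)$ is the monoid of all cellular automata over $A^G$ under composition. The stabiliser of $x \in A^G$ is $G_x := \{g\in G : x\cdot g = x\}$, and its $G$-orbit is $xG=\{x\cdot g : g\in G\}$. For a subgroup $H\leq G$, $[H]$ denotes its conjugacy class in $G$, the box is $B_{[H]} := \{x\in A^G : [G_x]=[H]\}$ (a union of $G$-orbits), and $N_G(H) := \{g\in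 G : gHg^{-1}=H\}$. For an integer $\alpha\geq 1$, $\mathrm{Tran}_\alpha$ is the monoid of all functions from a set of size $\alpha$, here $\{1,\dots,\alpha\}$, to itself. For a group $C$, the wreath product of $C$ by $\mathrm{Tran}_\alpha$ is the monoid $C\wr \mathrm{Tran}_\alpha := \{(v,f) : v\in C^\alpha, f\in \mathrm{Tran}_\alpha\}$ with operation $(v,f)\cdot(w,g) = (v(f\cdot w), f\circ g)$, where $f\cdot (w_1,\dots,w_\alpha) := (w_{(1)f},\dots,w_{(\alpha)f})$ and the product in $C^\alpha$ is componentwise. *)

(* Defs.v *)
From HB Require Import structures.
From mathcomp Require Import all_boot all_fingroup.

Set Implicit Arguments.
Unset Strict Implicit.
Unset Printing Implicit Defensive.

Local Open Scope group_scope.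

Definition isomorphic_monoids (M N : monoidType) : Prop :=
  exists f : M -> N, monoid_morphism f /\ bijective f.

(* The full transformation monoid of a finite type.  It is kept apart from
   {ffun T -> T}, which the library endows with the pointwise product whenever
   T is a monoid.  Functions are composed from left to right: s * t is
   "first s, then t". *)
Definition tran (T : finType) : Type := {ffun T -> T}.

Section TranMonoid.
Variable T : finType.

HB.instance Definition _ := Finite.copy (tran T) {ffun T -> T}.

Definition tran_one : tran T := [ffun x => x].
Definition tran_mul (s t : tran T) : tran T := [ffun x => t (s x)].

Fact tran_mulA : associative tran_mul.
Proof. by move=> s t u; apply/ffunP=> x; rewrite !ffunE. Qed.

Fact tran_mul1 : left_id tran_one tran_mul.
Proof. by move=> s; apply/ffunP=> x; rewrite !ffunE. Qed.

Fact tran_1mul : right_id tran_one tran_mul.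
Proof. by move=> s; apply/ffunP=> x; rewrite !ffunE. Qed.

HB.instance Definition _ :=
  isMonoid.Build (tran T) tran_mulA tran_mul1 tran_1mul.

End TranMonoid.

(* An element (v, f) is multiplied by (w, g) as (v (f . w), f * g), where
   f . w := w o f, and C ^ n has the componentwise product. *)
Definition wreath (C : groupType) (n : nat) : Type :=
  ({ffun 'I_n -> C} * tran 'I_n)%type.

Section WreathMonoid.
Variables (C : groupType) (n : nat).

HB.instance Definition _ :=
  Choice.copy (wreath C n) ({ffun 'I_n -> C} * tran 'I_n)%type.

Definition wreath_act (f : tran 'I_n) (w : {ffun 'I_n -> C}) :
  {ffun 'I_n -> C} := [ffun i => w (f i)].

Definition wreath_one : wreath C n := (1, 1).
Definition wreath_mul (a b : wreath C n) : wreath C n :=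
  (a.1 * wreath_act a.2 b.1, a.2 * b.2).

Fact wreath_mulA : associative wreath_mul.
Proof.
move=> [v f] [w g] [u h]; congr (_, _) => /=; last by rewrite mulgA.
by apply/ffunP=> i; rewrite !ffunE mulgA.
Qed.

Fact wreath_mul1 : left_id wreath_one wreath_mul.
Proof.
move=> [v f]; congr (_, _) => /=; last by rewrite mul1g.
by apply/ffunP=> i; rewrite !ffunE mul1g.
Qed.

Fact wreath_1mul : right_id wreath_one wreath_mul.
Proof.
move=> [v f]; congr (_, _) => /=; last by rewrite mulg1.
by apply/ffunP=> i; rewrite !ffunE mulg1.
Qed.

HB.instance Definition _ :=
  isMonoid.Build (wreath C n) wreath_mulA wreath_mul1 wreath_1mul.

End WreathMonoid.

Definition prod_monoid (I : finType) (M : I -> monoidType) : Type :=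
  {dffun forall i : I, M i}.

Section ProdMonoid.
Variables (I : finType) (M : I -> monoidType).

HB.instance Definition _ :=
  Choice.copy (prod_monoid M) {dffun forall i : I, M i}.

Definition prod_one : prod_monoid M := [ffun i : I => (1 : M i)].
Definition prod_mul (a b : prod_monoid M) : prod_monoid M :=
  [ffun i : I => (a i * b i : M i)].

Fact prod_mulA : associative prod_mul.
Proof. by move=> a b c; apply/ffunP=> i; rewrite !ffunE mulgA. Qed.

Fact prod_mul1 : left_id prod_one prod_mul.
Proof. by move=> a; apply/ffunP=> i; rewrite !ffunE mul1g. Qed.

Fact prod_1mul : right_id prod_one prod_mul.
Proof. by move=> a; apply/ffunP=> i; rewrite !ffunE mulg1. Qed.

HB.instance Definition _ :=
  isMonoid.Build (prod_monoid M) prod_mulA prod_mul1 prod_1mul.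

End ProdMonoid.

Section CellularAutomata.
Variables (gT : finGroupType) (A : finType).

Definition config : Type := {ffun gT -> A}.
HB.instance Definition _ := Finite.copy config {ffun gT -> A}.

Definition shift_fun (x : config) (g : gT) : config :=
  [ffun h => x (h * g^-1)].

Fact shift_fun1 : forall x, shift_fun x 1 = x.
Proof. by move=> x; apply/ffunP=> h; rewrite ffunE invg1 mulg1. Qed.

Fact shift_funM : forall x, act_morph shift_fun x.
Proof. by move=> x g k; apply/ffunP=> h; rewrite !ffunE invMg mulgA. Qed.

Definition shift : {action gT &-> config} := TotalAction shift_fun1 shift_funM.

Definition restrict (S : {set gT}) (x : config) : {ffun {g | g \in S} -> A} :=
  [ffun s => x (val s)].

Definition has_local_function (tau : tran config) (S : {set gT})
    (mu : {ffun {ffun {g | g \in S} -> A} -> A}) : bool :=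
  [forall x : config, [forall g : gT,
     (tau x : config) g == mu (restrict S (shift x g^-1))]].

(* Memory sets and local functions range over finite types here, so that their
   existence is a boolean. *)
Definition cellular_automaton : {pred tran config} :=
  fun tau => [exists S : {set gT},
    [exists mu : {ffun {ffun {g | g \in S} -> A} -> A},
       has_local_function tau mu]].

Fact cellular_automatonP (tau : tran config) :
  reflect (forall x g, tau (shift x g) = shift (tau x) g)
          (tau \in cellular_automaton).
Proof.
apply: (iffP existsP) => [[S /existsP[mu /forallP ca]] x g | eqv].
  apply/ffunP=> h; rewrite [in RHS]ffunE.
  have /forallP/(_ h)/eqP -> := ca (shift x g).
  have /forallP/(_ (h * g^-1))/eqP -> := ca x.
  by rewrite -actM invMg invgK.
exists setT; apply/existsP.
exists [ffun y : {ffun {g | g \in [set: gT]} -> A} =>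
          (tau ([ffun g => y (exist _ g (in_setT g))] : config) : config) 1].
apply/forallP=> x; apply/forallP=> g; rewrite ffunE.
set z : config := [ffun _ => _].
have -> : z = shift x g^-1 by apply/ffunP=> h; rewrite ffunE [LHS]ffunE.
by rewrite eqv ffunE invgK mul1g.
Qed.

Fact cellular_automaton_closed : monoid_closed cellular_automaton.
Proof.
split=> [|s t /cellular_automatonP cs /cellular_automatonP ct].
  by apply/cellular_automatonP=> x g; rewrite !ffunE.
by apply/cellular_automatonP=> x g; rewrite !ffunE cs ct.
Qed.

Record CA : Type :=
  MkCA { ca_val :> tran config; _ : ca_val \in cellular_automaton }.

HB.instance Definition _ := [isSub for ca_val].
HB.instance Definition _ := [Finite of CA by <:].
HB.instance Definition _ :=
  SubChoice_isSubMonoid.Build (tran config) cellular_automaton CA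
    cellular_automaton_closed.

Definition stabiliser_preserving : {pred CA} :=
  fun sigma => [forall x : config, 'C[x | shift] == 'C[ca_val sigma x : config | shift]].

Fact stabiliser_preserving_closed : monoid_closed stabiliser_preserving.
Proof.
split=> [|s t /forallP ps /forallP pt]; apply/forallP=> x.
  by rewrite /= ffunE.
by rewrite /= ffunE (eqP (ps x)); apply: pt.
Qed.

Record stabCA : Type :=
  MkStabCA { stabca_val :> CA; _ : stabca_val \in stabiliser_preserving }.

HB.instance Definition _ := [isSub for stabca_val].
HB.instance Definition _ := [Finite of stabCA by <:].
HB.instance Definition _ :=
  SubChoice_isSubMonoid.Build CA stabiliser_preserving stabCA
    stabiliser_preserving_closed.

Definition conj_class (H : {set gT}) : {set {set gT}} := H :^: [set: gT].

Definition box (H : {set gT}) : {set config} :=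
  [set x | conj_class 'C[x | shift] == conj_class H].

Definition config_orbits : {set {set config}} :=
  [set orbit shift [set: gT] x | x : config].

Definition alpha (H : {set gT}) : nat :=
  #|[set O in config_orbits | O \subset box H]|.

End CellularAutomata.

(* Main.v *)
Require Import Defs.
From HB Require Import structures.
From mathcomp Require Import all_boot all_fingroup.

Set Implicit Arguments.
Unset Strict Implicit.
Unset Printing Implicit Defensive.

Local Open Scope group_scope.

(** In each orbit [O] of the box of [H i] choose a configuration [x_O] with
    stabiliser exactly [H i].  If [s] preserves stabilisers, then [x_O] and
    [s x_O] have the same stabiliser, so [s x_O . n = x_O'] for a unique orbit
    [O'] of the same box and an element [n] of the normaliser of [H i] which is
    unique modulo [H i].  The pairs [(n H i, O')] determine [s] by equivariance,
    and can be prescribed freely.  It is [s x_O . n = x_O'], rather than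
    [s x_O = x_O' . n], that makes the order of the factors agree with the
    wreath product. *)

Section Coordinates.
Variables (gT : finGroupType) (A : finType) (r : nat) (H : 'I_r -> {group gT}).
Hypothesis hH : forall K : {group gT},
  exists! i : 'I_r, conj_class K = conj_class (H i).

Local Notation config := (config gT A).
Local Notation to := (shift gT A).
Local Notation box i := (box A (H i)).
Local Notation orbit_idx i := 'I_(alpha A (H i)).
Local Notation wreaths :=
  (prod_monoid (fun i => wreath [subg 'N(H i) / H i]%type (alpha A (H i)))).

Implicit Types (x y : config) (s t : stabCA gT A) (p q : wreaths).

Lemma mem_boxP (K : {set gT}) x :
  reflect (exists g, 'C[x | to] = K :^ g) (x \in Defs.box A K).
Proof.
rewrite inE; apply: (iffP eqP) => [eK | [g eK]].
  have: 'C[x | to] \in conj_class K.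
    by rewrite -eK; apply/imsetP; exists 1; rewrite ?conjsg1 ?inE.
  by case/imsetP=> g _ ->; exists g.
apply/setP=> B; rewrite eK; apply/imsetP/imsetP=> -[h _ ->].
  by exists (g * h); rewrite ?inE ?conjsgM.
by exists (g^-1 * h); rewrite ?inE // conjsgM conjsgK.
Qed.

(** Acting by [g] conjugates the stabiliser by [g]. A point of the orbit has stabiliser [H i :^ g]
    for some [g], so moving it by [g^-1] gives [H i] on the nose without leaving the orbit. *)
Fact repr_config_exists i (j : orbit_idx i) :
  exists x, ('C[x | to] == H i) && (orbit to setT x == enum_val j).
Proof.
have := enum_valP j; rewrite inE => /andP[/imsetP[x _ ->] /subsetP sub].
have /mem_boxP[g eC] := sub x (orbit_refl _ _ _).
exists (to x g^-1); rewrite astab1_act eC conjsgK eqxx /=.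
by rewrite orbit_act ?inE.
Qed.

Definition repr_config i (j : orbit_idx i) : config := xchoose (repr_config_exists j).

Lemma stab_repr_config i (j : orbit_idx i) : 'C[repr_config j | to] = H i.
Proof. by have /andP[/eqP-> _] := xchooseP (repr_config_exists j). Qed.

Lemma orbit_repr_config i (j : orbit_idx i) :
  orbit to setT (repr_config j) = enum_val j.
Proof. by have /andP[_ /eqP->] := xchooseP (repr_config_exists j). Qed.

Lemma repr_config_cover i x : x \in box i ->
  exists (j : orbit_idx i) g, x = to (repr_config j) g.
Proof.
move=> /mem_boxP[g0 eC].
have Ox : orbit to setT x \in
    [set O in config_orbits gT A | O \subset box i].
  rewrite inE imset_f //=; apply/subsetP=> _ /orbitP[h _ <-].
  by apply/mem_boxP; exists (g0 * h); rewrite astab1_act eC conjsgM.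
exists (enum_rank_in Ox (orbit to setT x)).
have: x \in orbit to setT (repr_config (enum_rank_in Ox (orbit to setT x))).
  by rewrite orbit_repr_config enum_rankK_in // orbit_refl.
by case/orbitP=> g _ e; exists g.
Qed.

Lemma repr_config_spec x :
  exists i (j : orbit_idx i) g, x = to (repr_config j) g.
Proof.
have [i [eC _]] := hH 'C[x | to]%G.
by exists i; apply: repr_config_cover; rewrite inE eC.
Qed.

Lemma stab_to_repr_config i (j : orbit_idx i) g :
  'C[to (repr_config j) g | to] = H i :^ g.
Proof. by rewrite astab1_act stab_repr_config. Qed.

(** The stabiliser of the common configuration is conjugate to both [H i] and [H i']; uniqueness in
    [hH] concludes. *)
Lemma to_repr_config_box i i' (j : orbit_idx i) (j' : orbit_idx i') g g' :
  to (repr_config j) g = to (repr_config j') g' -> i = i'.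
Proof.
move=> e; have [k [_ uk]] := hH 'C[to (repr_config j) g | to]%G.
rewrite -(uk i) -1?(uk i') //.
  apply/eqP; move: (mem_boxP (H i') (to (repr_config j) g)); rewrite inE => P.
  by apply/P; exists g'; rewrite e stab_to_repr_config.
apply/eqP; move: (mem_boxP (H i) (to (repr_config j) g)); rewrite inE => P.
by apply/P; exists g; rewrite stab_to_repr_config.
Qed.

Lemma to_repr_config_orbit i (j j' : orbit_idx i) g g' :
  to (repr_config j) g = to (repr_config j') g' -> j = j'.
Proof.
move=> e; apply: enum_val_inj; rewrite -!orbit_repr_config.
by rewrite -(orbit_act to _ (in_setT g)) e orbit_act ?inE.
Qed.

Lemma eq_actP x g g' : reflect (to x g = to x g') (g * g'^-1 \in 'C[x | to]).
Proof.
apply: (iffP astab1P) => [e | e]; last by rewrite actM e actK.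
by rewrite -{2}e -actM mulgKV.
Qed.

Definition lift_coset i (c : [subg 'N(H i) / H i]) : gT := repr (sgval c).

Lemma coset_lift i (c : [subg 'N(H i) / H i]) :
  coset (H i) (lift_coset c) = sgval c.
Proof. exact: coset_reprK. Qed.

Lemma lift_coset_norm i (c : [subg 'N(H i) / H i]) : lift_coset c \in 'N(H i).
Proof. exact: repr_coset_norm. Qed.

(** [lift_coset] picks arbitrary representatives, so it is multiplicative only modulo [H i]. *)
Lemma coset_liftM i (c d : [subg 'N(H i) / H i]) :
  coset (H i) (lift_coset (c * d)) = coset (H i) (lift_coset c * lift_coset d).
Proof. by rewrite morphM ?lift_coset_norm //= !coset_lift. Qed.

(** The quotient of the normaliser by [H i] thus acts freely on configurations with stabiliser
    [H i]: the choice of a lift is harmless and the coset is determined by its effect. *)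
Lemma eq_act_coset i x g g' : 'C[x | to] = H i ->
  g \in 'N(H i) -> g' \in 'N(H i) ->
  (to x g == to x g') = (coset (H i) g == coset (H i) g').
Proof.
move=> eC Ng Ng'; apply/eqP/eqP => [/eq_actP | e].
  rewrite eC => Hgg'; apply/(rcoset_kercosetP Ng Ng').
  by rewrite mem_rcoset.
apply/eq_actP; rewrite eC -mem_rcoset.
exact/(rcoset_kercosetP Ng Ng').
Qed.

(** Kept as a relation: once it is shown total and single-valued in both directions and compatible
    with products, its graph is the isomorphism. *)
Definition coordinates s p : bool :=
  [forall i, [forall j : orbit_idx i,
    to (ca_val s (repr_config j) : config) (lift_coset ((p i).1 j))
      == repr_config ((p i).2 j)]].

Lemma coordinatesP s p :
  reflect (forall i (j : orbit_idx i),
             to (ca_val s (repr_config j)) (lift_coset ((p i).1 j))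
               = repr_config ((p i).2 j))
          (coordinates s p).
Proof.
by apply: (iffP forallP) => h i; [move=> j; apply/eqP; apply: (forallP (h i)) |
  apply/forallP=> j; apply/eqP].
Qed.

Lemma stabCA_act s x g : ca_val s (to x g) = to (ca_val s x) g.
Proof. by have /cellular_automatonP-> := valP (val s). Qed.

Lemma stabCA_stab s x : 'C[ca_val s x : config | to] = 'C[x | to].
Proof. by have /forallP/(_ x)/eqP-> := valP s. Qed.

Lemma stab_stabCA_repr s i (j : orbit_idx i) :
  'C[ca_val s (repr_config j) : config | to] = H i.
Proof. by rewrite stabCA_stab stab_repr_config. Qed.

Lemma coordinates_exist s : exists p, coordinates s p.
Proof.
have ex i (j : orbit_idx i) : exists c : [subg 'N(H i) / H i] * orbit_idx i,
    to (ca_val s (repr_config j)) (lift_coset c.1) == repr_config c.2.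
  have /repr_config_cover[j' [g e]] : (ca_val s (repr_config j) : config) \in box i.
    by rewrite inE stab_stabCA_repr.
  (* The two sides of [e] have stabilisers [H i] and [H i :^ g]. *)
  have Ng : g \in 'N(H i).
    rewrite inE -(stab_to_repr_config j') -e stab_stabCA_repr.
    exact: subxx.
  have Nc : coset (H i) g^-1 \in 'N(H i) / H i by rewrite mem_quotient ?groupV.
  exists (subg _ (coset (H i) g^-1), j').
  rewrite -(actK to g (repr_config j')) -e (@eq_act_coset i) ?stab_stabCA_repr //.
  - by rewrite coset_lift /= subgK.
  - exact: lift_coset_norm.
  - by rewrite groupV.
exists [ffun i => ([ffun j => (xchoose (ex i j)).1],
                   [ffun j => (xchoose (ex i j)).2])].
apply/coordinatesP=> i j; rewrite !ffunE; exact/eqP/(xchooseP (ex i j)).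
Qed.

Lemma coordinates_unique s p q :
  coordinates s p -> coordinates s q -> p = q.
Proof.
move=> /coordinatesP sp /coordinatesP sq; apply/ffunP=> i.
have e2 j : (p i).2 j = (q i).2 j.
  apply: (@to_repr_config_orbit i _ _ (lift_coset ((p i).1 j))^-1
    (lift_coset ((q i).1 j))^-1).
  by rewrite -sp -sq !actK.
have e1 j : (p i).1 j = (q i).1 j.
  apply: val_inj; rewrite /= -!coset_lift; apply/eqP.
  rewrite -(@eq_act_coset i (ca_val s (repr_config j))) ?stab_stabCA_repr
    ?lift_coset_norm //.
  by rewrite sp sq e2.
by apply: injective_projections; apply/ffunP.
Qed.

Lemma coordinates_inj s t p : coordinates s p -> coordinates t p -> s = t.
Proof.
move=> /coordinatesP sp /coordinatesP tp; do 2!apply: val_inj.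
apply/ffunP=> x; have [i [j [g ->]]] := repr_config_spec x.
rewrite !stabCA_act; congr (to _ g).
by apply: (act_inj to (lift_coset ((p i).1 j))); rewrite sp tp.
Qed.

Lemma coordinates_surj p : exists s, coordinates s p.
Proof.
(* The coordinates force the image of [repr_config j] to be [repr_config ((p i).2 j)] moved by the
   inverse lift; equivariance then forces the image of every translate. *)
pose im i (j : orbit_idx i) g : config :=
  to (repr_config ((p i).2 j)) ((lift_coset ((p i).1 j))^-1 * g).
(* Independence of [g]: for a lift [n], the quotient of the two acting elements is the conjugate by
   [n] of [g * g'^-1], and [n] normalises [H i]. *)
have imE i (j : orbit_idx i) g g' :
    to (repr_config j) g = to (repr_config j) g' -> im i j g = im i j g'.
  move/eq_actP; rewrite stab_repr_config => Hg; apply/eq_actP.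
  rewrite stab_repr_config invMg invgK -!mulgA (mulgA g).
  by rewrite -conjgE memJ_norm ?lift_coset_norm.
(* Requiring the value for all expressions of [x] as a translate at once lets [xchoose] define the
   map with no chosen expression. *)
have ex x : exists y, [forall i, [forall j : orbit_idx i, [forall g,
    (x == to (repr_config j) g) ==> (y == im i j g)]]].
  have [i [j [g ->]]] := repr_config_spec x; exists (im i j g).
  apply/forallP=> i'; apply/forallP=> j'; apply/forallP=> g'.
  (* The box indices must be identified first, since only then do [j] and [j'] have the same
     type. *)
  apply/implyP=> /eqP e; have ei := to_repr_config_box e; case: i' / ei j' e => j' e.
  by have ej := to_repr_config_orbit e; case: j' / ej e => /imE->.
pose s0 : tran config := [ffun x => xchoose (ex x)].
have s0E i (j : orbit_idx i) g : s0 (to (repr_config j) g) = im i j g.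
  rewrite ffunE; set x := to _ _.
  have /forallP/(_ i)/forallP/(_ j)/forallP/(_ g) := xchooseP (ex x).
  by rewrite eqxx /= => /eqP.
have caP : s0 \in @cellular_automaton gT A.
  apply/cellular_automatonP=> x g; have [i [j [h ->]]] := repr_config_spec x.
  by rewrite -[LHS]/(s0 (to (to _ _) _)) -actM !s0E /im mulgA actM.
have stP : MkCA caP \in @stabiliser_preserving gT A.
  apply/forallP=> x /=; have [i [j [h ->]]] := repr_config_spec x.
  rewrite s0E !stab_to_repr_config conjsgM.
  by rewrite [_ :^ _^-1](normP _) ?groupV ?lift_coset_norm.
exists (MkStabCA stP); apply/coordinatesP=> i j.
by rewrite -[ca_val _]/s0 -[repr_config j in LHS](act1 to) s0E /im mulg1 actKV.
Qed.

Lemma coordinates1 : coordinates 1 1.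
Proof.
apply/coordinatesP=> i j; rewrite !ffunE.
(* The chosen representative of the trivial coset is [1] itself. *)
by rewrite /lift_coset repr_coset1 act1.
Qed.

(** With lifts [n] at [j] for [s] and [m] at [(p i).2 j] for [t], equivariance of [t] moves [n]
    outside, so the image of [repr_config j] under [s * t] is moved by [n * m]: this is the twisted
    product of the wreath product. *)
Lemma coordinatesM s t p q :
  coordinates s p -> coordinates t q -> coordinates (s * t) (p * q).
Proof.
move=> /coordinatesP sp /coordinatesP tq; apply/coordinatesP=> i j.
rewrite ffunE /= !ffunE -tq -sp stabCA_act -actM.
apply/eqP; rewrite (@eq_act_coset i) ?groupM ?lift_coset_norm //.
  exact/eqP/coset_liftM.
by rewrite !stabCA_stab stab_repr_config.
Qed.

End Coordinates.

Theorem theorem6 (gT : finGroupType) (A : finType) (hA : 2 <= #|A|)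
    (r : nat) (H : 'I_r -> {group gT})
    (hH : forall K : {group gT},
            exists! i : 'I_r, conj_class K = conj_class (H i)) :
  isomorphic_monoids (stabCA gT A)
    (prod_monoid (fun i : 'I_r =>
       wreath [subg 'N(H i) / H i]%type (alpha A (H i)))).
Proof.
pose f s := xchoose (@coordinates_exist gT A r H s).
pose g p := xchoose (@coordinates_surj gT A r H hH p).
have fP s : coordinates s (f s) by apply: (xchooseP (coordinates_exist H s)).
have gP p : coordinates (g p) p by apply: (xchooseP (coordinates_surj hH p)).
exists f; split; first split.
- exact: coordinates_unique (fP 1) (@coordinates1 _ _ _ _).
- by move=> s t; apply: coordinates_unique (fP _) (coordinatesM (fP s) (fP t)).
exists g => [s | p].
  exact: (coordinates_inj hH (gP (f s)) (fP s)).
exact: coordinates_unique (fP _) (gP p).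
Qed.
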